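(* Suppose $\eta_{N,M,r}$ satisfies $0<\check\eta\le\eta_{N,M,r}\le\hat\eta$ for all $N$, with constants $\check\eta,\hat\eta$ independent of $N$. Then for any $0<\epsilon<1$ there exist $N'$ and $M'>0$ such that, for all $N>N'$, at most $2M'$ eigenvalues of the matrix $(\tilde{\mathcal P}_{N-1})^{-1}\tilde{\mathcal M}_{N-1}-I$ have absolute values exceeding $\epsilon$.
   Context: Let $0<\gamma<1$, $\alpha\in(0,2)$, $\mu\in(\alpha,2]$, $\nu=\mu-\alpha$, $\kappa_\mu=1$ if $\mu\in(\alpha,2)$ and $\kappa_\mu=2$ if $\mu=2$. For each $N$ let $\tilde A=\tilde A_{N-1}=[\tilde a_{ij}]_{i,j=1,\dots,N-1}$ be the symmetric Toeplitz matrix $$\tilde a_{ij}=\begin{cases}\sum\limits_{\ell=2}^{N-1}\frac{(\ell+1)^\nu-(\ell-1)^\nu}{\ell^\mu}+\frac{N^\nu-(N-1)^\nu}{N^\mu}+(2^\nu+\kappa_\mu-1)+\frac{2\nu}{\alpha N^\alpha},& j=i,\\[2mm] -\frac{2^\nu+\kappa_\mu-1}{2},& j=i\pm1,\\[1mm] -\frac{(|j-i|+1)^\nu-(|j-i|-1)^\nu}{2|j-i|^\mu},& j\neq i,\,i\pm1,\end{cases}$$ and let $s(\tilde A)$ be its Strang circulant approximation: the circulant matrix of order $N-1$ with first column $[\tilde a_{11},\dots,\tilde a_{1,\lfloor (N+1)/2\rfloor},\tilde a_{1,\lfloor N/2\rfloor},\dots,\tilde a_{12}]^\top$. The diffusivity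 is taken independent of $x$, and, following the paper's convention, the dependence on the time level $m$ is suppressed: $\kappa>0$ denotes a constant (the diffusivity value), and $\eta_{N,M,r}=\frac{b^{(m,\gamma)}_m}{\Gamma(1-\gamma)C^h_{\alpha,\mu}}$, where $b^{(m,\gamma)}_m=\frac1{\tau_m}\int_{t_{m-1}}^{t_m}(t_m-s)^{-\gamma}ds$, $t_m=(m/M)^rT$, $\tau_m=t_m-t_{m-1}$, $C^h_{\alpha,\mu}=\frac{c_{1,\alpha}}{\nu h^\alpha}$, $h=2l/N$, $c_{1,\alpha}=\frac{2^{\alpha-1}\alpha\Gamma(\frac{\alpha+1}{2})}{\sqrt\pi\,\Gamma(1-\alpha/2)}$, with fixed $T,l>0$ and positive integers $M,r$ chosen depending on $N$. Put $$\tilde{\mathcal M}_{N-1}=\eta_{N,M,r}I+\kappa\tilde A_{N-1},\qquad \tilde{\mathcal P}_{N-1}=\eta_{N,M,r}I+\kappa\,s(\tilde A_{N-1}).$$ The number $M'$ in the claim does not depend on $N$ and is unrelated to $M$. *)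

(* Defs.v *)
From mathcomp Require Import all_boot all_order all_algebra.
From mathcomp Require Import complex.
From mathcomp Require Import all_classical all_reals all_analysis.
Set Implicit Arguments.
Unset Strict Implicit.
Unset Printing Implicit Defensive.
Import Order.TTheory GRing.Theory Num.Theory.
Import numFieldNormedType.Exports.
Local Open Scope classical_set_scope.
Local Open Scope complex_scope.
Local Open Scope ring_scope.

(* The library has no Gamma function; this is Euler's integral, for 0 < x. *)
Definition Gamma_fun (R : realType) (x : R) : R :=
  \int[lebesgue_measure]_(t in `]0, +oo[) (t `^ (x - 1) * expR (- t)).

Section Coefficients.
Variable R : realType.
Implicit Types (alpha mu gamma T l : R) (N M r m : nat).

Definition kappa_mu mu : R := if mu == 2 then 2 else 1.

(* Entries of A~ at distance d = |j - i| from the diagonal. *)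
Definition a_entry alpha mu N (d : nat) : R :=
  let nu := mu - alpha in
  match d with
  | 0 => \sum_(2 <= k < N)
            (k.+1%:R `^ nu - k.-1%:R `^ nu) / k%:R `^ mu
         + (N%:R `^ nu - N.-1%:R `^ nu) / N%:R `^ mu
         + (2 `^ nu + kappa_mu mu - 1)
         + 2 * nu / (alpha * N%:R `^ alpha)
  | 1 => - ((2 `^ nu + kappa_mu mu - 1) / 2)
  | _ => - ((d.+1%:R `^ nu - d.-1%:R `^ nu) / (2 * d%:R `^ mu))
  end.

Definition A_tilde alpha mu N : 'M[R]_(N.-1) :=
  \matrix_(i, j) a_entry alpha mu N `|(i : int) - (j : int)|.

Definition c1 alpha : R :=
  2 `^ (alpha - 1) * alpha * Gamma_fun ((alpha + 1) / 2)
  / (Num.sqrt pi * Gamma_fun (1 - alpha / 2)).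

Definition mesh l N : R := 2 * l / N%:R.

Definition C_h alpha mu l N : R :=
  c1 alpha / ((mu - alpha) * mesh l N `^ alpha).

Definition tpoint T M r m : R := (m%:R / M%:R) ^+ r * T.

Definition tau T M r m : R := tpoint T M r m - tpoint T M r m.-1.

Definition b_coef gamma T M r m : R :=
  (tau T M r m)^-1 *
  \int[lebesgue_measure]_(s in `[tpoint T M r m.-1, tpoint T M r m])
    (tpoint T M r m - s) `^ (- gamma).

Definition eta alpha mu gamma T l N M r m : R :=
  b_coef gamma T M r m / (Gamma_fun (1 - gamma) * C_h alpha mu l N).

End Coefficients.

Section Matrices.
Variable R : realType.

(* insubd i k is the index k of 'I_n (the default i is used only if n <= k);
   i + (n - j) avoids truncated subtraction in i - j modulo n. *)
Definition circulant n (c : 'cV[R]_n) : 'M[R]_n :=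
  \matrix_(i, j) c (insubd i ((i + (n - j)) %% n)%N) ord0.

(* With n = N - 1 and 0-based indices, the first column is
   A 0 0, ..., A 0 n./2, followed by A 0 (n - k) for n./2 < k < n;
   floor((N + 1) / 2) = n./2.+1. *)
Definition strang n (A : 'M[R]_n) : 'M[R]_n :=
  circulant (\col_k A (insubd k 0%N)
                      (insubd k (if (k < n./2.+1)%N then k : nat
                                 else (n - k)%N))).

(* Complex eigenvalues, repeated according to algebraic multiplicity. *)
Definition eigenvalues n (A : 'M[R]_n) : seq R[i] :=
  sval (closed_field_poly_normal (char_poly (map_mx (real_complex R) A))).

Definition M_tilde (e kappa alpha mu : R) N : 'M[R]_(N.-1) :=
  e%:M + kappa *: A_tilde alpha mu N.

Definition P_tilde (e kappa alpha mu : R) N : 'M[R]_(N.-1) :=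
  e%:M + kappa *: strang (A_tilde alpha mu N).

End Matrices.

(* Main.v *)
Require Import Defs.
From mathcomp Require Import all_boot all_order all_algebra.
From mathcomp Require Import complex.
From mathcomp Require Import all_classical all_reals all_analysis.
From mathcomp Require Import ring lra zify.
Import Order.TTheory GRing.Theory Num.Theory.
Import numFieldNormedType.Exports.
Local Open Scope complex_scope.
Local Open Scope ring_scope.

(** The difference of the two matrices is B = M - P = kappa (A - s(A)), so the
    matrix of the statement is P^-1 B, with P and B real symmetric. The entries
    of A at distance d >= 1 from the diagonal are nonpositive, of size
    O(d^(-1-alpha)), hence summable in d, and the diagonal of A dominates twice
    their sum.

    The circulant s(A) replaces the entry at distance d by the one at distance
    min (d, n - d), where n = N - 1. So each off-diagonal row sum of s(A) is at
    most the diagonal entry, and P, being e + kappa s(A) with e >= eta_lo, is at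
    least eta_lo as a quadratic form (P_tilde_dominant, qform_diag_dominant).
    Moreover B is supported on d > n / 2, where its entry involves the distances
    d and n - d. If the indices below K are discarded, then d < n - K for the
    remaining pairs, both distances exceed K, and the row sums of |B| are at most
    2 kappa times a tail of the convergent series (toeplitz_strang_gap). For K
    large, independent of N, the form of B is therefore at most eps * eta_lo |w|^2
    in absolute value at every w that vanishes on the K discarded coordinates.

    As P is positive definite, some Z satisfies Z P Z^H = 1 and
    Z B Z^H = diag (lam), and lam lists the eigenvalues of P^-1 B with
    multiplicity (hermitian_pencil_diag, char_poly_pencil). If more than K of
    them exceeded eps, then some nonzero combination w of the corresponding
    eigenvectors would vanish on the K coordinates; there w B w^H > eps w P w^H
    >= eps * eta_lo |w|^2, a contradiction (card_eigen_gt). The same holds for - B,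
    which gives 2 K in all (clustering). Symmetry is essential: for general
    matrices, the sum of a small one and one of low rank can have many large
    eigenvalues; P^-1 B is self-adjoint for the inner product defined by P. *)

Set Implicit Arguments.
Unset Strict Implicit.

Local Open Scope sesquilinear_scope.

(** * Hermitian forms and pencils *)

Section HermitianPencil.
Context {C : numClosedFieldType}.

Definition qform {n} (A : 'M[C]_n) (w : 'rV[C]_n) : C := (w *m A *m w^t*) 0 0.
Definition sqnorm {n} (w : 'rV[C]_n) : C := \sum_j `|w 0 j| ^+ 2.

Lemma hermsym_of_adjoint n (A : 'M[C]_n) : A^t* = A -> A \is hermsymmx.
Proof. by move=> hA; apply/is_hermitianmxP; rewrite expr0 scale1r hA. Qed.

Lemma adjoint_mul m n p (A : 'M[C]_(m, n)) (B : 'M[C]_(n, p)) :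
  (A *m B)^t* = B^t* *m A^t*.
Proof. by rewrite trmx_mul map_mxM. Qed.

Lemma qform_mul n (A Z : 'M[C]_n) x : qform A (x *m Z) = qform (Z *m A *m Z^t*) x.
Proof. by rewrite /qform adjoint_mul !mulmxA. Qed.

Lemma qform_diag n (d : 'rV[C]_n) x :
  qform (diag_mx d) x = \sum_i d 0 i * `|x 0 i| ^+ 2.
Proof.
rewrite /qform mxE; apply: eq_bigr => i _.
by rewrite mul_mx_diag !mxE normCK mulrCA mulrA.
Qed.

Lemma qform1 n x : qform (1%:M : 'M[C]_n) x = sqnorm x.
Proof.
rewrite /qform mulmx1 mxE; apply: eq_bigr => i _.
by rewrite !mxE normCK.
Qed.

Lemma sqnorm_ge0 n (w : 'rV[C]_n) : 0 <= sqnorm w.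
Proof. by apply: sumr_ge0 => i _; rewrite exprn_ge0. Qed.

Lemma sqnorm_gt0 n (w : 'rV[C]_n) : w != 0 -> 0 < sqnorm w.
Proof.
move=> w0; rewrite lt0r sqnorm_ge0 andbT; apply: contraNneq w0 => sq0.
apply/eqP/rowP => j; rewrite mxE; apply/eqP; rewrite -normr_eq0 -sqrf_eq0.
by apply/eqP; apply: (psumr_eq0P _ sq0) => // i _; rewrite exprn_ge0.
Qed.

Lemma hermitian_diagonalization n (A : 'M[C]_n) : A^t* = A ->
  exists (U : 'M[C]_n) (d : 'rV[C]_n),
    [/\ U *m U^t* = 1%:M, U *m A *m U^t* = diag_mx d & d \is a realmx].
Proof.
move=> /hermsym_of_adjoint hA; exists (spectralmx A), (spectral_diag A).
have sU := spectral_unitarymx A.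
have -> := hermitian_spectral_diag_real hA; split => //; first exact/unitarymxP.
have /orthomx_spectralP eA := hermitian_normalmx hA.
rewrite {2}eA -!mulmxA mulKVmx ?unitarymx_unit//.
by rewrite (unitarymxP sU) mulmx1.
Qed.

(** Normalising P to the identity through its own diagonalisation turns B into a
    Hermitian matrix; diagonalising that one by a unitary matrix leaves the
    identity in place. *)
Lemma hermitian_pencil_diag n (P B : 'M[C]_n) : P^t* = P -> B^t* = B ->
    (forall w, w != 0 -> 0 < qform P w) ->
  exists (Z : 'M[C]_n) (lam : 'rV[C]_n),
    [/\ Z *m P *m Z^t* = 1%:M, Z *m B *m Z^t* = diag_mx lam & lam \is a realmx].
Proof.
move=> hP hB Ppos.
have [U [d [UU UPU dreal]]] := hermitian_diagonalization hP.
have dgt0 i : 0 < d 0 i.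
  have -> : d 0 i = qform P (row i U).
    have := congr1 (fun X : 'M[C]_n => X i i) UPU.
    rewrite /= [in RHS]mxE eqxx mulr1n => <-.
    rewrite /qform -row_mul !mxE; apply: eq_bigr => j _.
    by rewrite !mxE.
  apply: Ppos; apply/eqP => Ui0.
  have := congr1 (fun X : 'M[C]_n => X i i) UU; rewrite /= !mxE eqxx mulr1n.
  rewrite big1 => [/esym/eqP|j _]; first by rewrite oner_eq0.
  have := congr1 (fun v : 'rV[C]_n => v 0 j) Ui0; rewrite !mxE => ->.
  by rewrite mul0r.
(* s is d^(-1/2), so that diag(s) U maps P to the identity. *)
pose s : 'rV[C]_n := \row_i (sqrtC (d 0 i))^-1.
have sreal i : Num.conj (s 0 i) = s 0 i.
  rewrite mxE; apply/CrealP; rewrite realV; apply: ger0_real.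
  by rewrite sqrtC_ge0 ltW.
have sadj : (diag_mx s)^t* = diag_mx s.
  rewrite tr_diag_mx map_diag_mx; congr diag_mx; apply/rowP => j.
  by rewrite [LHS]mxE; exact: sreal.
pose Y := diag_mx s *m U.
have YPY : Y *m P *m Y^t* = 1%:M.
  rewrite /Y adjoint_mul sadj.
  have -> : diag_mx s *m U *m P *m (U^t* *m diag_mx s) =
            diag_mx s *m (U *m P *m U^t*) *m diag_mx s by rewrite !mulmxA.
  rewrite UPU !mulmx_diag -diag_const_mx; congr diag_mx; apply/rowP => j.
  rewrite !mxE -[X in _ * X * _]sqrtCK expr2.
  by rewrite mulKf ?mulfV// sqrtC_eq0 gt_eqF.
(* Y is made opaque: as a product it would be expanded under the adjoint. *)
move: (Y) YPY => {}Y YPY.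
have hH : (Y *m B *m Y^t*)^t* = Y *m B *m Y^t*.
  by rewrite 2!adjoint_mul trmxCK hB mulmxA.
have [V [lam [VV VHV lreal]]] := hermitian_diagonalization hH.
exists (V *m Y), lam; split => //.
  rewrite adjoint_mul.
  have -> : V *m Y *m P *m (Y^t* *m V^t*) = V *m (Y *m P *m Y^t*) *m V^t*.
    by rewrite !mulmxA.
  by rewrite YPY mulmx1.
by rewrite -VHV adjoint_mul !mulmxA.
Qed.

Lemma char_poly_similar n (S A D : 'M[C]_n) :
  S \in unitmx -> A *m S = S *m D -> char_poly A = char_poly D.
Proof.
move=> Su AS; rewrite /char_poly.
have detS : \det (map_mx polyC S) != 0.
  by rewrite det_map_mx polyC_eq0 -unitfE -unitmxE.
apply: (mulIf detS); rewrite [RHS]mulrC -!det_mulmx; congr (\det _).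
rewrite /char_poly_mx mulmxBl mulmxBr -!map_mxM AS; congr (_ - _).
by rewrite scalar_mxC.
Qed.

(** Since P^-1 = Z^H Z, the matrix P^-1 B is Z^H diag(lam) Z^-H; similarity makes
    lam the spectrum with algebraic multiplicities. *)
Lemma char_poly_pencil n (P B Z : 'M[C]_n) lam :
    Z *m P *m Z^t* = 1%:M -> Z *m B *m Z^t* = diag_mx lam ->
  P \in unitmx /\ char_poly (invmx P *m B) = \prod_i ('X - (lam 0 i)%:P).
Proof.
move=> ZPZ ZBZ.
have [ZPu Zau] := mulmx1_unit ZPZ.
have [Zu Pu] : Z \in unitmx /\ P \in unitmx by apply/andP; rewrite -unitmx_mul.
split=> //; rewrite (@char_poly_similar _ (Z^t*) _ (diag_mx lam))//.
  rewrite char_poly_trig ?diag_mx_is_trig//.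
  by apply: eq_bigr => i _; rewrite mxE eqxx mulr1n.
apply: (@row_full_inj _ _ _ _ (Z *m P)); first by rewrite row_full_unit.
rewrite [in RHS]mulmxA ZPZ mul1mx -ZBZ -!mulmxA; congr (Z *m _).
by rewrite mulKVmx.
Qed.

(** The |J| linear conditions on |I| free coordinates have a nonzero solution. *)
Lemma row_vanishing n (Z : 'M[C]_n) (I J : {set 'I_n}) : (#|J| < #|I|)%N ->
  exists x : 'rV[C]_n, [/\ x != 0, forall i, i \notin I -> x 0 i = 0
    & forall j, j \in J -> (x *m Z) 0 j = 0].
Proof.
move=> JI.
pose W : 'M[C]_(#|I|, #|J|) := \matrix_(i, j) Z (enum_val i) (enum_val j).
have /rowV0Pn[y /sub_kermxP yW y0] : kermx W != 0.
  rewrite kermx_eq0 /row_free neq_ltn (leq_ltn_trans _ JI)//.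
  exact: rank_leq_col.
pose x : 'rV[C]_n := y *m \matrix_(i, j) (j == enum_val i)%:R.
have xI i : x 0 (enum_val i) = y 0 i.
  rewrite !mxE (bigD1 i)//= !mxE eqxx mulr1 big1 ?addr0// => k ki.
  by rewrite !mxE (inj_eq enum_val_inj) eq_sym (negPf ki) mulr0.
have xnI i : i \notin I -> x 0 i = 0.
  move=> iI; rewrite !mxE big1// => k _; rewrite !mxE; case: eqP => [e|].
    by rewrite e enum_valP in iI.
  by rewrite mulr0.
exists x; split=> //.
  apply: contraNneq y0 => x0; apply/eqP/rowP => i.
  by rewrite -xI x0 !mxE.
move=> j jJ; rewrite mxE (bigID (mem I))/= [X in _ + X]big1 ?addr0; last first.
  by move=> i /xnI ->; rewrite mul0r.
transitivity ((y *m W) 0 (enum_rank_in jJ j)); last by rewrite yW mxE.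
rewrite [RHS]mxE [LHS]big_enum_val; apply: eq_bigr => i _.
by rewrite xI mxE enum_rankK_in.
Qed.

(** A combination w of the pencil eigenvectors for eigenvalues above eps
    satisfies w B w^H > eps w P w^H >= eps eta |w|^2. By dimension, more than |J|
    of these eigenvectors have a nonzero combination vanishing on J, where the
    upper bound on the form of B is violated. *)
Lemma card_eigen_gt n (P B Z : 'M[C]_n) lam (eta eps : C) (J : {set 'I_n}) :
    Z *m P *m Z^t* = 1%:M -> Z *m B *m Z^t* = diag_mx lam ->
    0 <= eps ->
    (forall w : 'rV[C]_n, eta * sqnorm w <= qform P w) ->
    (forall w : 'rV[C]_n, (forall j, j \in J -> w 0 j = 0) ->
      qform B w <= eps * eta * sqnorm w) ->
  (#|[set i | (eps < lam 0 i)%R]| <= #|J|)%N.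
Proof.
move=> ZPZ ZBZ eps0 Plow Bup; rewrite leqNgt; apply/negP => /row_vanishing.
move=> /(_ Z)[x [x0 xI xJ]].
have wB : qform B (x *m Z) = \sum_i lam 0 i * `|x 0 i| ^+ 2.
  by rewrite qform_mul ZBZ qform_diag.
have wP : qform P (x *m Z) = sqnorm x by rewrite qform_mul ZPZ qform1.
have : eps * sqnorm x < qform B (x *m Z).
  rewrite wB mulr_sumr.
  have /rV0Pn[i xi0] := x0.
  have lami j : x 0 j != 0 -> eps < lam 0 j.
    by move=> xj; apply: contraNT xj => ej; apply/eqP/xI; rewrite inE.
  rewrite (bigD1 i)//= [ltRHS](bigD1 i)//=; apply: ltr_leD.
    by rewrite ltr_pM2r ?lami// exprn_gt0// normr_gt0.
  apply: ler_sum => j _; have [->|xj] := eqVneq (x 0 j) 0.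
    by rewrite normr0 expr0n !mulr0.
  by rewrite ler_pM2r ?ltW ?lami// exprn_gt0// normr_gt0.
have : qform B (x *m Z) <= eps * sqnorm x.
  by rewrite (le_trans (Bup _ xJ))// -mulrA ler_wpM2l// -wP.
by move=> /le_lt_trans /[apply]; rewrite ltxx.
Qed.

Lemma qform_real n (A : 'M[C]_n) w : A^t* = A -> qform A w \is Num.real.
Proof.
move=> hA; apply/CrealP; rewrite /qform.
have : (w *m A *m w^t*)^t* = w *m A *m w^t*.
  by rewrite 2!adjoint_mul trmxCK hA mulmxA.
by move=> /(congr1 (fun X : 'M[C]_1 => X 0 0)); rewrite !mxE.
Qed.

Lemma qformE n (A : 'M[C]_n) w :
  qform A w = \sum_i \sum_j A i j * (w 0 i * Num.conj (w 0 j)).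
Proof.
rewrite exchange_big /qform mxE; apply: eq_bigr => j _.
rewrite !mxE mulr_suml; apply: eq_bigr => i _.
by rewrite mulrCA -mulrA mulrCA mulrA mulrC mulrCA.
Qed.

(** Schur's test: 2 |w_i| |w_j| <= |w_i|^2 + |w_j|^2, and the two halves agree by
    symmetry of |A|. *)
Lemma norm_qform_le n (A : 'M[C]_n) w : A^t* = A ->
  `|qform A w| <= \sum_i (\sum_j `|A i j|) * `|w 0 i| ^+ 2.
Proof.
move=> hA; have sA i j : `|A j i| = `|A i j|.
  by rewrite -[in LHS]hA !mxE norm_conjC.
rewrite -(ler_pM2l (ltr0n _ 2)) qformE.
apply: (@le_trans _ _ (2%:R * \sum_i \sum_j `|A i j| * (`|w 0 i| * `|w 0 j|))).
  rewrite ler_wpM2l// (le_trans (ler_norm_sum _ _ _))//; apply: ler_sum => i _.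
  rewrite (le_trans (ler_norm_sum _ _ _))//; apply: ler_sum => j _.
  by rewrite !normrM norm_conjC.
have -> : 2%:R * (\sum_i (\sum_j `|A i j|) * `|w 0 i| ^+ 2) =
    \sum_i \sum_j `|A i j| * (`|w 0 i| ^+ 2 + `|w 0 j| ^+ 2).
  transitivity (\sum_i \sum_j `|A i j| * `|w 0 i| ^+ 2 +
                \sum_i \sum_j `|A i j| * `|w 0 j| ^+ 2); last first.
    rewrite -big_split/=; apply: eq_bigr => i _; rewrite -big_split/=.
    by apply: eq_bigr => j _; rewrite mulrDr.
  rewrite mulr_natl mulr2n; congr (_ + _).
    by apply: eq_bigr => i _; rewrite mulr_suml.
  rewrite exchange_big; apply: eq_bigr => i _; rewrite mulr_suml.
  by apply: eq_bigr => j _; rewrite sA.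
rewrite mulr_sumr; apply: ler_sum => i _.
rewrite mulr_sumr; apply: ler_sum => j _.
rewrite mulrCA ler_wpM2l// -subr_ge0.
have -> : `|w 0 i| ^+ 2 + `|w 0 j| ^+ 2 - 2%:R * (`|w 0 i| * `|w 0 j|) =
   (`|w 0 i| - `|w 0 j|) ^+ 2 by rewrite sqrrB addrAC mulr_natl.
by rewrite real_exprn_even_ge0// rpredB.
Qed.

(** Only the block of A outside J matters, so the row sums of that block bound the
    form. *)
Lemma norm_qform_off n (A : 'M[C]_n) (w : 'rV[C]_n) (J : {set 'I_n}) delta :
    A^t* = A ->
    (forall i, i \notin J -> \sum_(j | j \notin J) `|A i j| <= delta) ->
    (forall j, j \in J -> w 0 j = 0) ->
  `|qform A w| <= delta * sqnorm w.
Proof.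
move=> hA rowA wJ.
pose A' := \matrix_(i, j) if (i \in J) || (j \in J) then 0 else A i j.
have -> : qform A w = qform A' w.
  rewrite !qformE; apply: eq_bigr => i _; apply: eq_bigr => j _.
  rewrite [in RHS]mxE; case: ifP => // /orP[]/wJ ->;
    by rewrite ?rmorph0 ?mul0r ?mulr0.
have hA' : A'^t* = A'.
  apply/matrixP => i j; rewrite !mxE orbC; case: ifP => _; first exact: rmorph0.
  by rewrite -[in RHS]hA !mxE.
rewrite (le_trans (norm_qform_le w hA'))// mulr_sumr; apply: ler_sum => i _.
have [/wJ ->|iJ] := boolP (i \in J); first by rewrite normr0 expr0n !mulr0.
rewrite ler_wpM2r ?exprn_ge0// (le_trans _ (rowA i iJ))//.
rewrite [leRHS]big_mkcond/=; apply: ler_sum => j _.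
by rewrite mxE (negPf iJ)/=; case: (j \in J) => //=; rewrite normr0.
Qed.

(** A quantitative Gershgorin bound: the off-diagonal part costs at most its row
    sums. *)
Lemma qform_diag_dominant n (A : 'M[C]_n) w eta : A^t* = A ->
    (forall i, eta + \sum_(j | j != i) `|A i j| <= A i i) ->
  eta * sqnorm w <= qform A w.
Proof.
move=> hA domA.
pose D := diag_mx (\row_i A i i); pose A' := A - D.
have hA' : A'^t* = A'.
  apply/matrixP => i j; rewrite !mxE rmorphB rmorphMn /= -[in RHS]hA !mxE.
  by case: eqVneq => [->|/negPf ji]; rewrite ?eqxx// eq_sym ji.
have -> : qform A w = qform D w + qform A' w.
  by rewrite /qform -[in LHS](subrK D A) mulmxDr mulmxDl mxE addrC.
have := real_lerNnormlW (qform_real w hA') (norm_qform_le w hA').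
rewrite -(lerD2l (qform D w)); apply: le_trans.
rewrite qform_diag -sumrB mulr_sumr; apply: ler_sum => i _.
rewrite mxE -mulrBl ler_wpM2r ?exprn_ge0// lerBrDr.
apply: le_trans (domA i); rewrite lerD2l [leRHS]big_mkcond/=.
apply: ler_sum => j _; rewrite !mxE eq_sym.
by case: eqVneq => [->|ji]; rewrite ?mulr1n ?mulr0n ?subrr ?subr0 ?normr0.
Qed.

End HermitianPencil.

(** * Clustering of the spectrum of a real symmetric pencil *)

Section Clustering.
Variable R : realType.

Lemma eigenvalues_perm n (A : 'M[R]_n) (lam : 'rV[R[i]]_n) :
    char_poly (map_mx (real_complex R) A) = \prod_i ('X - (lam 0 i)%:P) ->
  perm_eq (eigenvalues A) [seq lam 0 i | i <- enum 'I_n].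
Proof.
move=> chA; apply: prod_XsubC_eq; rewrite big_map big_enum/= -chA /eigenvalues.
case: closed_field_poly_normal => s /= ->.
by rewrite (monicP (char_poly_monic _)) scale1r.
Qed.

Lemma adjoint_real_complex n (A : 'M[R]_n) : A^T = A ->
  (map_mx (real_complex R) A)^t* = map_mx (real_complex R) A.
Proof.
move=> hA; apply/matrixP => i j; rewrite !mxE -[in RHS]hA mxE.
by apply/CrealP; rewrite complex_real.
Qed.

(** The eigenvalues of P^-1 B are real, so those of modulus above eps are above
    eps for the pencil (P, B) or for the pencil (P, - B); each contributes at most
    #|J|. *)
Lemma clustering n (P B : 'M[R]_n) (J : {set 'I_n}) (eta eps : R) :
    P^T = P -> B^T = B -> 0 < eta -> 0 <= eps ->
    (forall i, eta + \sum_(j | j != i) `|P i j| <= P i i) ->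
    (forall i, i \notin J -> \sum_(j | j \notin J) `|B i j| <= eps * eta) ->
  P \in unitmx /\
  (count (fun z : R[i] => (eps%:C < `|z|)%R) (eigenvalues (invmx P *m B))
     <= 2 * #|J|)%N.
Proof.
move=> symP symB eta0 eps0 domP rowB.
set f := real_complex R.
have hP := adjoint_real_complex symP; have hB := adjoint_real_complex symB.
rewrite -/f in hP hB.
have normf (x : R) : `|f x| = f `|x|.
  by rewrite normc_def/= expr0n addr0 sqrtr_sqr.
have Plow w : f eta * sqnorm w <= qform (map_mx f P) w.
  apply: qform_diag_dominant => // i; rewrite mxE.
  under eq_bigr => j _ do rewrite mxE normf.
  by rewrite -rmorph_sum -rmorphD lecR.
have Bup (w : 'rV_n) : (forall j, j \in J -> w 0 j = 0) ->
    `|qform (map_mx f B) w| <= f eps * f eta * sqnorm w.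
  apply: norm_qform_off => // i iJ; rewrite -rmorphM.
  under eq_bigr => j _ do rewrite mxE normf.
  by rewrite -rmorph_sum lecR rowB.
have Ppos (w : 'rV_n) : w != 0 -> 0 < qform (map_mx f P) w.
  move=> w0; apply: lt_le_trans (Plow w).
  by rewrite mulr_gt0 ?sqnorm_gt0// ltcR.
have [Z [lam [ZPZ ZBZ lamR]]] := hermitian_pencil_diag hP hB Ppos.
have [Pu chi] := char_poly_pencil ZPZ ZBZ.
split; first by rewrite -(map_unitmx f).
have eps0C : 0 <= f eps by rewrite lecR.
have hi : (#|[set i | (f eps < lam 0 i)%R]| <= #|J|)%N.
  apply: (card_eigen_gt ZPZ ZBZ eps0C Plow) => w wJ.
  exact: le_trans (real_ler_norm (qform_real _ hB)) (Bup w wJ).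
have lo : (#|[set i | (f eps < (- lam) 0 i)%R]| <= #|J|)%N.
  apply: (@card_eigen_gt _ _ _ (- map_mx f B) _ (- lam) _ _ _ ZPZ _ eps0C Plow).
    rewrite mulmxN mulNmx ZBZ.
    by apply/matrixP => i j; rewrite !mxE mulNrn.
  move=> w wJ; have -> : qform (- map_mx f B) w = - qform (map_mx f B) w.
    by rewrite /qform mulmxN mulNmx mxE.
  by rewrite lerNl; apply: real_lerNnormlW (qform_real _ hB) (Bup w wJ).
have chA : char_poly (map_mx f (invmx P *m B)) = \prod_i ('X - (lam 0 i)%:P).
  by rewrite map_mxM map_invmx.
rewrite (seq.permP (eigenvalues_perm chA)) count_map -size_filter.
rewrite -(card_uniqP (filter_uniq _ (enum_uniq _))).
have -> : #|[seq i <- enum 'I_n |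
               preim (lam 0) (fun z : R[i] => (f eps < `|z|)%R) i]|
    = #|[set i | (f eps < `|lam 0 i|)%R]|.
  by apply: eq_card => i; rewrite mem_filter mem_enum andbT inE.
rewrite mul2n -addnn; apply: leq_trans (leq_add hi lo).
rewrite -cardsUI -[X in (X <= _)%N]addn0; apply: leq_add => //.
apply: subset_leq_card; apply/fintype.subsetP => i; rewrite !inE /= mxE.
have /mxOverP/(_ 0 i) li := lamR.
by rewrite real_ltr_normr.
Qed.

End Clustering.

(** * Row sums of Toeplitz and Strang matrices *)

(** The distances below and above the diagonal are 1, ..., i and 1, ..., n - 1 - i;
    reflecting the latter by k -> n - k completes 1, ..., n - 1. *)
Lemma sum_toeplitz_row (V : zmodType) n (g : nat -> V) (i : 'I_n) :
    (forall k, (0 < k < n)%N -> g (n - k)%N = g k) ->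
  \sum_(j < n | j != i) g `|(i : int) - (j : int)|%N = \sum_(1 <= k < n) g k.
Proof.
move=> symg.
transitivity (\sum_(0 <= j < n | j != i :> nat) g `|(i : int) - (j : int)|%N).
  by rewrite big_mkord.
rewrite (@big_cat_nat _ _ _ i)//=; last exact: ltnW.
rewrite [X in _ + X]big_ltn_cond// eqxx/=.
rewrite [RHS](@big_cat_nat _ _ _ i.+1)//=; congr (_ + _).
  rewrite big_nat_rev/= [RHS]big_add1/= big_nat_cond [RHS]big_nat_cond.
  by apply: eq_big => k; [lia | move=> kk; congr g; lia].
rewrite [RHS]big_nat_rev/= [LHS]big_nat_cond [RHS]big_nat_cond.
apply: eq_big => k; first by lia.
move=> kk; rewrite -[LHS]symg; last by lia.
by congr g; lia.
Qed.

(** Any G becomes reflection invariant after adding its mirror image, which makes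
    the row sum independent of the row. *)
Lemma sum_toeplitz_row_reflected (V : zmodType) n (G : nat -> V) (i : 'I_n) :
  \sum_(j < n | j != i) (G `|(i : int) - (j : int)|%N +
                         G (n - `|(i : int) - (j : int)|)%N) =
  (\sum_(1 <= k < n) G k) *+ 2.
Proof.
rewrite (sum_toeplitz_row _ (g := fun k => G k + G (n - k)%N)); last first.
  by move=> k kn; rewrite addrC subKn//; lia.
rewrite big_split/= mulr2n; congr (_ + _); rewrite big_nat_rev/=.
by rewrite big_nat_cond [RHS]big_nat_cond; apply: eq_bigr => k kn; congr G; lia.
Qed.

(** The k-th entry of the first column is at distance min (k, n - k), a function
    that takes the same value at i - j modulo n and at |i - j|. *)
Lemma strang_toeplitz (R : realType) n (A : 'M[R]_n) (a : nat -> R) :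
    (forall i j, A i j = a `|(i : int) - (j : int)|%N) ->
  forall i j, strang A i j =
    let d := `|(i : int) - (j : int)|%N in a (minn d (n - d)).
Proof.
move=> Aa i j; rewrite !mxE Aa /=.
have n0 : (0 < n)%N by apply: leq_ltn_trans (ltn_ord i).
set k := ((i + (n - j)) %% n)%N.
have kn : (k < n)%N by rewrite ltn_pmod.
have kE : k = (if (j <= i)%N then i - j else n - (j - i))%N.
  have := ltn_ord i; have := ltn_ord j; rewrite /k; case: (leqP j i) => ij jn i_n.
    by rewrite addnBA 1?ltnW// addnC -addnBA// modnDl modn_small; lia.
  by rewrite modn_small; lia.
rewrite !val_insubd kn n0.
have -> : ((if (k < n./2.+1)%N then k else n - k) < n)%N by case: ifP => ?; lia.
have := ltn_ord i; have := ltn_ord j => jn i_n.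
congr a; rewrite kE; case: (leqP j i) => ij; case: ifP; lia.
Qed.

(** * Decay of the coefficients *)

Section Coef.
Variable R : realType.
Variables (alpha mu : R).
Hypotheses (alpha0 : 0 < alpha) (amu : alpha < mu) (mu2 : mu <= 2).

(** Opposite of the entries, hence nonnegative off the diagonal. For d > 0 they do
    not depend on N, so N = 0 is an arbitrary choice; offdiag 0 has no meaning. *)
Definition offdiag d : R := - a_entry alpha mu 0 d.

Lemma a_entry_offdiag N d : (0 < d)%N -> a_entry alpha mu N d = - offdiag d.
Proof. by rewrite /offdiag opprK; case: d => [|[|d]]. Qed.

Let nu0 : 0 < mu - alpha. Proof. by rewrite subr_gt0. Qed.
Let nu2 : mu - alpha <= 2. Proof. by move: alpha0 mu2 => a0 m2; lra. Qed.

Lemma offdiagE d : (1 < d)%N ->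
  offdiag d =
    (d.+1%:R `^ (mu - alpha) - d.-1%:R `^ (mu - alpha)) / (2 * d%:R `^ mu).
Proof. by rewrite /offdiag; case: d => [|[|d]]//= _; rewrite opprK. Qed.

Lemma offdiag_ge0 d : (0 < d)%N -> 0 <= offdiag d.
Proof.
case: d => [//|[_|d _]].
  rewrite /offdiag/= opprK divr_ge0// /kappa_mu.
  have := powR_gt0 (mu - alpha) (ltr0n R 2); case: ifP => _ h; lra.
rewrite offdiagE// divr_ge0 ?mulr_ge0 ?powR_ge0//.
by rewrite subr_ge0 ge0_ler_powR ?nnegrE ?ler0n ?ltW// ltr_nat; lia.
Qed.

(** With t = 1 / d, the exponent mu - alpha <= 2 gives
    (1 + t)^(mu - alpha) - (1 - t)^(mu - alpha) <= (1 + 3 t) - (1 - 2 t) = 5 t, so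
    offdiag d <= 5/2 d^(-1-alpha); and (1 - t)^(-alpha) >= 1 + alpha t compares
    d^(-1-alpha) with a telescoping difference. *)
Lemma offdiag_le d : (1 < d)%N ->
  offdiag d <= 5 / (2 * alpha) * (d.-1%:R `^ (- alpha) - d%:R `^ (- alpha)).
Proof.
move: nu0 nu2 alpha0 => n0 n2 a0 d1.
have d0 : 0 < d%:R :> R by rewrite ltr0n; lia.
pose t : R := d%:R^-1.
have t0 : 0 < t by rewrite invr_gt0.
have t1 : t <= 1 / 2.
  by rewrite /t mul1r lef_pV2 ?posrE// ler_nat.
have dS : d.+1%:R = d%:R * (1 + t) by rewrite mulrDr mulfV ?gt_eqF// mulr1 -natr1.
have dP : d.-1%:R = d%:R * (1 - t).
  rewrite mulrBr mulfV ?gt_eqF// mulr1 -[in RHS](@prednK d); last by lia.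
  by rewrite -natr1 addrK.
rewrite offdiagE// dS dP !powRM//; try by [exact: ltW | lra].
have up : (1 + t) `^ (mu - alpha) <= 1 + 3 * t.
  apply: (@le_trans _ _ ((1 + t) `^ 2)).
    by apply: ler_powR => //; lra.
  by rewrite powR_mulrn; nra.
have lo : 1 - 2 * t <= (1 - t) `^ (mu - alpha).
  apply: (@le_trans _ _ ((1 - t) `^ 2)); first by rewrite powR_mulrn; nra.
  by apply: ger_powR => //; lra.
have mid : 1 + alpha * t <= (1 - t) `^ (- alpha).
  rewrite /powR gt_eqF; last by lra.
  apply: le_trans (expR_ge1Dx _); rewrite lerD2l mulNr -mulrN ler_pM2l//.
  by rewrite lerNr; apply: le_ln1Dx; lra.
rewrite -mulrBr.
have -> : d%:R `^ (mu - alpha) = d%:R `^ mu * d%:R `^ (- alpha).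
  by rewrite powRD// gt_eqF ?implybT.
have x0 := powR_gt0 mu d0; have y0 := powR_gt0 (- alpha) d0.
move: (d%:R `^ mu) (d%:R `^ (- alpha)) ((1 + t) `^ (mu - alpha))
  ((1 - t) `^ (mu - alpha)) ((1 - t) `^ (- alpha)) x0 y0 up lo mid.
move=> x y u v z x0 y0 up lo mid.
have -> : x * y * (u - v) / (2 * x) = y * ((u - v) / 2) by field; rewrite gt_eqF.
have -> : 5 / (2 * alpha) * (y * z - y) = y * (5 / (2 * alpha) * (z - 1)).
  by field; rewrite gt_eqF.
rewrite ler_pM2l//.
apply: (@le_trans _ _ (5 / (2 * alpha) * (alpha * t))).
  have -> : 5 / (2 * alpha) * (alpha * t) = 5 * t / 2 by field; rewrite gt_eqF.
  by lra.
by rewrite ler_pM2l ?divr_gt0 ?mulr_gt0//; lra.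
Qed.

Lemma offdiag_tail K n : (0 < K)%N ->
  \sum_(K.+1 <= d < n) offdiag d <= 5 / (2 * alpha) * K%:R `^ (- alpha).
Proof.
move=> K0; have [nK|nK] := leqP n K.+1.
  by rewrite big_geq// mulr_ge0 ?powR_ge0// divr_ge0// mulr_ge0// ltW.
apply: (@le_trans _ _ (5 / (2 * alpha) * \sum_(K <= d < n.-1)
   (d%:R `^ (- alpha) - d.+1%:R `^ (- alpha)))).
  rewrite big_add1 mulr_sumr big_nat_cond [leRHS]big_nat_cond.
  by apply: ler_sum => d dK; apply: offdiag_le; lia.
apply: ler_wpM2l; first by rewrite divr_ge0 ?mulr_ge0// ltW.
under eq_bigr => d _ do rewrite -opprB.
rewrite sumrN telescope_sumr; last by lia.
by rewrite opprB lerBlDr lerDl powR_ge0.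
Qed.

Lemma offdiag_tail_small delta : 0 < delta ->
  exists2 K, (0 < K)%N & forall n, \sum_(K.+1 <= d < n) offdiag d <= delta.
Proof.
move=> delta0.
(* x solves 5 / (2 alpha) x^(-alpha) = delta. *)
pose x := (2 * alpha * delta / 5) `^ (- alpha^-1).
have x0 : 0 < x by rewrite powR_gt0// divr_gt0// !mulr_gt0.
exists (Num.truncn x).+1 => // n.
apply: le_trans (offdiag_tail _ _) _ => //.
apply: (@le_trans _ _ (5 / (2 * alpha) * x `^ (- alpha))).
  apply: ler_wpM2l; first by rewrite divr_ge0 ?mulr_ge0// ltW.
  rewrite !powRN lef_pV2 ?posrE; [|by apply: powR_gt0..].
  apply: ge0_ler_powR; rewrite ?nnegrE ?ltW//.
  exact: truncnS_gt.
rewrite -powRrM mulrNN mulVf ?gt_eqF// powRr1; last first.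
  by rewrite divr_ge0// !mulr_ge0 ?ltW.
by rewrite le_eqVlt; apply/orP; left; apply/eqP; field; rewrite gt_eqF.
Qed.

(** The sum inside the diagonal entry is 2 (offdiag 2 + ... + offdiag (N - 1)), and
    2^(mu - alpha) + kappa_mu - 1 is 2 offdiag 1; the other terms are nonnegative. *)
Lemma diag_entry_ge N : (1 < N)%N ->
  2 * \sum_(1 <= d < N.-1) offdiag d <= a_entry alpha mu N 0.
Proof.
move=> N1.
have rest0 : 0 <= (N%:R `^ (mu - alpha) - N.-1%:R `^ (mu - alpha)) / N%:R `^ mu.
  rewrite divr_ge0 ?powR_ge0// subr_ge0 ge0_ler_powR ?nnegrE ?ler0n ?ltW//.
  by rewrite ltr_nat; lia.
have bdry0 : 0 <= 2 * (mu - alpha) / (alpha * N%:R `^ alpha).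
  by rewrite divr_ge0 ?mulr_ge0 ?powR_ge0 ?ltW.
have sum0 : \sum_(2 <= d < N) 2 * offdiag d =
    \sum_(2 <= k < N)
      (k.+1%:R `^ (mu - alpha) - k.-1%:R `^ (mu - alpha)) / k%:R `^ mu.
  rewrite big_nat_cond [RHS]big_nat_cond; apply: eq_bigr => d d1.
  rewrite offdiagE; last by lia.
  field; rewrite gt_eqF// powR_gt0// ltr0n; lia.
have first : 2 * offdiag 1 = 2 `^ (mu - alpha) + kappa_mu mu - 1.
  by rewrite /offdiag/= opprK; field.
apply: (@le_trans _ _ (2 * \sum_(1 <= d < N) offdiag d)).
  rewrite ler_pM2l// -[in leRHS](@prednK N); last by lia.
  by rewrite big_nat_recr/= ?lerDl ?offdiag_ge0//; lia.
rewrite big_ltn// mulrDr mulr_sumr sum0 first /=.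
by move: rest0 bdry0; lra.
Qed.

End Coef.

(** * The preconditioned matrices *)

Lemma card_ord_lt n K : (#|[set i : 'I_n | (i < K)%N]| <= K)%N.
Proof.
rewrite cardE -(size_map val) -[leqRHS](size_iota 0).
apply: uniq_leq_size; first by rewrite (map_inj_uniq val_inj) enum_uniq.
by move=> _ /mapP[i + ->]; rewrite mem_enum inE mem_iota.
Qed.

Section Bounds.
Variable R : realType.
Variables (alpha mu : R).

Lemma A_tilde_sym N : (A_tilde alpha mu N)^T = A_tilde alpha mu N.
Proof. by apply/matrixP => i j; rewrite !mxE; congr a_entry; lia. Qed.

Lemma strang_A_tildeE N i j : strang (A_tilde alpha mu N) i j =
  let d := `|(i : int) - (j : int)|%N in a_entry alpha mu N (minn d (N.-1 - d)).
Proof. by apply: strang_toeplitz => k l; rewrite mxE. Qed.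

Lemma strang_A_tilde_sym N :
  (strang (A_tilde alpha mu N))^T = strang (A_tilde alpha mu N).
Proof.
apply/matrixP => i j; rewrite mxE !strang_A_tildeE/=.
by congr a_entry; lia.
Qed.

Hypotheses (alpha0 : 0 < alpha) (amu : alpha < mu) (mu2 : mu <= 2).

(** Bounding the entry at min (d, n - d) by the sum of those at d and n - d makes
    each row sum at most twice the series, that is, at most the diagonal. *)
Lemma strang_dominant N (i : 'I_N.-1) : (1 < N)%N ->
  \sum_(j | j != i) `|strang (A_tilde alpha mu N) i j| <=
    strang (A_tilde alpha mu N) i i.
Proof.
move=> N1; rewrite [leRHS]strang_A_tildeE/= subrr min0n.
apply: le_trans (diag_entry_ge alpha0 amu mu2 N1).
rewrite mulr_natl -(sum_toeplitz_row_reflected _ i); apply: ler_sum => j ji.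
have jn := ltn_ord j; have i_n := ltn_ord i.
have {}ji : (j != i :> nat) by [].
rewrite strang_A_tildeE/= a_entry_offdiag; last by lia.
have pos k : (0 < k)%N -> 0 <= offdiag alpha mu k by exact: offdiag_ge0.
rewrite normrN ger0_norm; last by apply: pos; lia.
rewrite /minn; case: ifP => _; first by rewrite lerDl pos//; lia.
by rewrite lerDr pos//; lia.
Qed.

(** The matrices differ only where n - d < d. For two indices that are both at
    least K this leaves d and n - d above K, so that truncating offdiag to
    distances above K loses nothing. *)
Lemma toeplitz_strang_gap K N (i : 'I_N.-1) : (K <= i)%N ->
  \sum_(j < N.-1 | (K <= j)%N)
     `|A_tilde alpha mu N i j - strang (A_tilde alpha mu N) i j| <=
   2 * \sum_(K.+1 <= d < N.-1) offdiag alpha mu d.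
Proof.
move=> Ki.
pose G d := if (K < d)%N then offdiag alpha mu d else 0.
have pos k : (0 < k)%N -> 0 <= offdiag alpha mu k by exact: offdiag_ge0.
have G0 k : 0 <= G k by rewrite /G; case: ifP => // ?; apply: pos; lia.
have -> : \sum_(K.+1 <= d < N.-1) offdiag alpha mu d = \sum_(1 <= d < N.-1) G d.
  have [KN|NK] := leqP K.+1 N.-1.
    rewrite [RHS](@big_cat_nat _ _ _ K.+1)//=.
    have -> : \sum_(1 <= d < K.+1) G d = 0.
      by rewrite big_nat_cond big1// => d dK; rewrite /G ifF//; lia.
    rewrite add0r.
    rewrite big_nat_cond [RHS]big_nat_cond; apply: eq_bigr => d dK.
    by rewrite /G ifT//; lia.
  rewrite big_geq 1?ltnW// big_nat_cond big1// => d dN; rewrite /G ifF//; lia.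
rewrite mulr_natl -(sum_toeplitz_row_reflected _ i).
rewrite big_mkcond [leRHS]big_mkcond; apply: ler_sum => j _.
have jn := ltn_ord j; have i_n := ltn_ord i.
rewrite mxE strang_A_tildeE/=.
have [->|ji] := eqVneq j i; first by rewrite subrr min0n subrr normr0 if_same.
case: ifP => Kj; last by rewrite addr_ge0.
have {}ji : (j != i :> nat) by [].
set d := `|_|%N.
have [dn|nd] := leqP d (N.-1 - d); first by rewrite subrr normr0 addr_ge0.
rewrite !a_entry_offdiag; try lia.
have := pos (N.-1 - d)%N; have := pos d; rewrite /G !ifT; try lia.
move: (offdiag _ _ _) (offdiag _ _ _) => a b /(_ ltac:(lia)) a0 /(_ ltac:(lia)) b0.
by rewrite ler_norml; lra.
Qed.

Lemma P_tilde_dominant e eta_lo kappa N (i : 'I_N.-1) : (1 < N)%N ->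
    eta_lo <= e -> 0 < kappa ->
  eta_lo + \sum_(j | j != i) `|P_tilde e kappa alpha mu N i j| <=
    P_tilde e kappa alpha mu N i i.
Proof.
move=> N1 lo k0.
have PE k l : P_tilde e kappa alpha mu N k l =
    e *+ (k == l) + kappa * strang (A_tilde alpha mu N) k l.
  by rewrite mxE [_%:M k l]mxE [X in _ + X]mxE.
rewrite PE eqxx mulr1n; apply: lerD => //.
apply: le_trans (ler_wpM2l (ltW k0) (strang_dominant i N1)).
rewrite mulr_sumr; apply: ler_sum => j ji.
by rewrite PE eq_sym (negPf ji) mulr0n add0r normrM (gtr0_norm k0).
Qed.

End Bounds.
Unset Implicit Arguments.
Set Strict Implicit.
Local Close Scope sesquilinear_scope.

Theorem corollary3p1 (R : realType) (gamma alpha mu T l kappa : R)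
    (M r m : nat -> nat) (eta_lo eta_hi : R) :
  0 < gamma < 1 ->
  0 < alpha < 2 ->
  alpha < mu <= 2 ->
  0 < T -> 0 < l -> 0 < kappa ->
  (forall N : nat, (2 <= N)%N ->
     [/\ (0 < M N)%N, (0 < r N)%N & (1 <= m N <= M N)%N]) ->
  0 < eta_lo ->
  (forall N : nat, (2 <= N)%N ->
     eta_lo <= eta alpha mu gamma T l N (M N) (r N) (m N) <= eta_hi) ->
  forall eps : R, 0 < eps < 1 ->
  exists (N' M' : nat), (0 < M')%N /\
    forall N : nat, (N' < N)%N ->
      let e := eta alpha mu gamma T l N (M N) (r N) (m N) in
      let Mt := M_tilde e kappa alpha mu N in
      let Pt := P_tilde e kappa alpha mu N in
      Pt \in unitmx /\
      (count (fun z : R[i] => (eps%:C < `|z|)%R)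
         (eigenvalues (invmx Pt *m Mt - 1%:M)) <= 2 * M')%N.
Proof.
move=> _ /andP[alpha0 _] /andP[amu mu2] _ _ kappa0 _ eta0 eta_bnd eps.
move=> /andP[eps0 _].
(* The factor 2 is that of toeplitz_strang_gap: kappa * (2 delta) = eps * eta_lo. *)
pose delta := eps * eta_lo / (2 * kappa).
have delta0 : 0 < delta by rewrite divr_gt0 ?mulr_gt0.
have [K K0 tailK] := offdiag_tail_small alpha0 amu mu2 delta0.
exists 1%N, K; split=> // N N1 e Mt Pt.
have /andP[lo _] := eta_bnd N N1.
pose J := [set i : 'I_N.-1 | (i < K)%N].
have symP : Pt^T = Pt.
  rewrite /Pt /P_tilde linearD linearZ/= tr_scalar_mx.
  by rewrite strang_A_tilde_sym.
have gapE : Mt - Pt = kappa *: (A_tilde alpha mu N - strang (A_tilde alpha mu N)).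
  by rewrite /Mt /Pt /M_tilde /P_tilde opprD addrACA subrr add0r scalerBr.
have symB : (Mt - Pt)^T = Mt - Pt.
  by rewrite gapE linearZ linearB/= A_tilde_sym strang_A_tilde_sym.
have domP i : eta_lo + \sum_(j | j != i) `|Pt i j| <= Pt i i.
  exact: P_tilde_dominant.
have rowB i : i \notin J -> \sum_(j | j \notin J) 
    `|(Mt - Pt) i j| <= eps * eta_lo.
  rewrite inE -leqNgt => Ki.
  have -> : eps * eta_lo = kappa * (2 * delta).
    by rewrite /delta; field; rewrite gt_eqF.
  have := toeplitz_strang_gap alpha0 amu mu2 Ki.
  move=> /le_trans/(_ (ler_wpM2l (ler0n _ 2) (tailK _))) gap.
  apply: le_trans (ler_wpM2l (ltW kappa0) gap).
  rewrite mulr_sumr [leRHS](eq_bigl (fun j => j \notin J)); last first.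
    by move=> j; rewrite inE -leqNgt.
  by apply: ler_sum => j _; rewrite gapE !mxE normrM gtr0_norm.
have [Pu cnt] := clustering symP symB eta0 (ltW eps0) domP rowB.
split => //; apply: leq_trans (leq_mul (leqnn 2) (card_ord_lt N.-1 K)).
have -> // : invmx Pt *m Mt - 1%:M = invmx Pt *m (Mt - Pt).
by rewrite mulmxBr mulVmx.
Qed.
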